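(* Let $k \ge 2$ be an integer and $N > 0$ a real number. Let $U_1,\dots,U_k$ be independent random variables uniformly distributed on $[0,N]$, and let $M_k$ and $M_{k-1}$ be the largest and second largest of $U_1,\dots,U_k$. Put $$X_k = M_k\,\frac{k+1}{k}, \qquad X_{k-1} = M_{k-1}\,\frac{k+1}{k-1},$$ and for $\alpha\in[0,1]$ let $X_\alpha = \alpha X_k + (1-\alpha)X_{k-1}$. Then the value of $\alpha\in[0,1]$ minimizing $\mathrm{Var}(X_\alpha)$ is $$\frac{\mathrm{Var}(X_{k-1}) - \mathrm{Cov}(X_k, X_{k-1})}{\mathrm{Var}(X_k) + \mathrm{Var}(X_{k-1}) - 2\,\mathrm{Cov}(X_k, X_{k-1})} = 1.$$
   Context: $X_\alpha$ (parameter $\alpha\in[0,1]$) denotes the weighted statistic and is distinct notation from $X_k$ and $X_{k-1}$, which denote the two unweighted estimators of $N$. *)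

(* Defs.v *)
From HB Require Import structures.
From mathcomp Require Import all_boot all_order all_algebra.
From mathcomp Require Import all_classical all_reals all_analysis.

Set Implicit Arguments.
Unset Strict Implicit.
Unset Printing Implicit Defensive.

Import Order.TTheory GRing.Theory Num.Theory.
Import numFieldNormedType.Exports.

Local Open Scope classical_set_scope.
Local Open Scope ring_scope.

Definition mutually_independent (d : measure_display) (T : measurableType d)
    (R : realType) (P : probability T R) (I : finType)
    (X : I -> {RV P >-> R}) : Prop :=
  forall (J : {set I}) (A : I -> set R), (forall i, measurable (A i)) ->
    P (\bigcap_(i in [set` J]) (X i @^-1` A i)) =
    (\prod_(i in J) P (X i @^-1` A i))%E.

(* Equality of laws is required on measurable sets only: elsewhere the values
   of a measure carry no meaning. *)
Definition uniformly_distributed (d : measure_display) (T : measurableType d)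
    (R : realType) (P : probability T R) (X : {RV P >-> R})
    (a b : R) (ab : a < b) : Prop :=
  forall A : set R, measurable A -> distribution P X A = uniform_prob ab A.

(* The values U i w, counted with multiplicity and listed in decreasing order:
   rank 0 is the largest, rank 1 the second largest. *)
Definition descending_stat (T : Type) (R : realType) (k : nat)
    (U : 'I_k -> T -> R) (rank : nat) : T -> R :=
  fun w => (sort >=%R [seq U i w | i <- enum 'I_k])`_rank.

Definition max_estimator (T : Type) (R : realType) (k : nat)
    (U : 'I_k -> T -> R) : T -> R :=
  fun w => descending_stat U 0 w * ((k%:R + 1) / k%:R).

Definition second_max_estimator (T : Type) (R : realType) (k : nat)
    (U : 'I_k -> T -> R) : T -> R :=
  fun w => descending_stat U 1 w * ((k%:R + 1) / (k%:R - 1)).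

Definition weighted_estimator (T : Type) (R : realType) (k : nat)
    (U : 'I_k -> T -> R) (alpha : R) : T -> R :=
  fun w => alpha * max_estimator U w + (1 - alpha) * second_max_estimator U w.

(* The quotient is taken in the extended reals, where variances and covariances
   live. There x / y = 1 forces x and y to be finite and y nonzero (0^-1 = +oo),
   so that equation loses nothing with respect to division of real numbers. *)
Definition weight_formula (d : measure_display) (T : measurableType d)
    (R : realType) (P : probability T R) (X Y : T -> R) : \bar R :=
  (('V_P[Y] - covariance P X Y) /
   ('V_P[X] + 'V_P[Y] - 2%:E * covariance P X Y))%E.

(* Main.v *)
Require Import Defs.
From HB Require Import structures.
From mathcomp Require Import all_boot all_order all_algebra.
From mathcomp Require Import all_classical all_reals all_analysis.
From mathcomp Require Import measurable_realfun lra ring.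

Set Implicit Arguments.
Unset Strict Implicit.
Unset Printing Implicit Defensive.

Import Order.TTheory GRing.Theory Num.Theory.
Import numFieldNormedType.Exports.

Local Open Scope classical_set_scope.
Local Open Scope ring_scope.

(** Write [M1] and [M2] for the largest and second largest value. Given [M1],
    the other [k - 1] values are independent and uniform below [M1], so that
    [E (M2 | M1) = (k - 1) / k * M1]; in terms of the two estimators,
    [E (X_k1 | X_k) = X_k]. The difference [D = X_k1 - X_k] therefore has mean
    zero and is uncorrelated with [X_k]. Since [X_ alpha = X_k + (1 - alpha) * D],
    its variance is [Var X_k + (1 - alpha) ^ 2 * Var D], and as [D] is not
    almost surely constant this is minimal exactly for [alpha = 1]. The quotient
    equals 1 for the same reason: [Cov (X_k, X_k1) = Var X_k] and
    [Var X_k1 = Var X_k + Var D], so it is [Var D / Var D]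
    ([variance_uncorrelated_line], [weight_formula_uncorrelated]).

    Orthogonality is obtained for the residual [W = k * M2 - (k - 1) * M1], a
    multiple of [D]. Conditioning on [M1] means integrating over the events
    [M1 <= x]: [conditional_expectation_second_max] says that [W] has integral
    zero over each of them. It rests on the joint distribution function of
    [M1] and [M2] ([top2_cdf]), which follows from a pointwise counting identity
    ([top2_count]) and independence. Passing from distribution functions to
    expectations, and from the events [M1 <= x] to the random variable
    [N - M1], is the same computation, the identity
    [E (g * max (c - X) 0) = \int_(y <= c) E (g ; X <= y) dy] of [layer_cake].
    That [W] has positive variance is seen on the event where one value exceeds
    [N / 2] and all others are at most [N / 8] ([variance_residual_gt0]). *)

(** * The two largest values of a finite family *)

Section top_two_order_statistics.
Context (T : Type) (R : realType) (k : nat) (U : 'I_k -> T -> R).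
Hypothesis hk : (2 <= k)%N.
Local Notation M1 := (descending_stat U 0).
Local Notation M2 := (descending_stat U 1).

Lemma descending_stat_top2 w : exists i0 i1 : 'I_k,
  [/\ i0 != i1, M1 w = U i0 w, M2 w = U i1 w, U i1 w <= U i0 w &
      forall j, j != i0 -> U j w <= U i1 w].
Proof.
pose r : rel 'I_k := relpre (U ^~ w) >=%R.
have r_total : total r by move=> i j; exact: ge_total.
have r_trans : transitive r by move=> i j l /= ij jl; exact: le_trans jl ij.
rewrite /descending_stat sort_map -/r.
have := sort_sorted r_total (enum 'I_k).
have : perm_eq (sort r (enum 'I_k)) (enum 'I_k) by rewrite perm_sort.
case: (sort r _) => [|i0 [|i1 t]] tP.
- by have := perm_size tP; rewrite size_enum_ord => /(congr1 (leq 2)); rewrite hk.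
- by have := perm_size tP; rewrite size_enum_ord => /(congr1 (leq 2)); rewrite hk.
rewrite /= (path_sortedE r_trans) => /and3P[i10 /allP i1t _].
exists i0, i1; split=> //.
- have : uniq [:: i0, i1 & t] by rewrite (perm_uniq tP) enum_uniq.
  by rewrite /= inE negb_or => /andP[/andP[]].
- move=> j ji0; have : j \in [:: i0, i1 & t] by rewrite (perm_mem tP) mem_enum.
  by rewrite !inE (negbTE ji0)/= => /predU1P[->//|/i1t].
Qed.

Lemma max_le_iff w x : M1 w <= x <-> forall i, U i w <= x.
Proof.
have [i0 [i1 [_ -> _ i10 i1P]]] := descending_stat_top2 w; split=> [i0x j|//].
by have [->//|/i1P/le_trans->//] := eqVneq j i0; exact: le_trans i10 i0x.
Qed.

(** The exceptional index is that of a maximum: discarding it leaves only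
    values that are at most the second largest. *)
Lemma second_max_le_iff w y :
  M2 w <= y <-> exists i, forall j, j != i -> U j w <= y.
Proof.
have [i0 [i1 [i01 _ -> i10 i1P]]] := descending_stat_top2 w.
split=> [i1y|[i iP]].
  by exists i0 => j /i1P/le_trans; apply.
have [i1i|/iP//] := eqVneq i1 i.
by apply: le_trans i10 _; apply: iP; rewrite -i1i.
Qed.

Lemma second_max_le_max w : M2 w <= M1 w.
Proof. by have [i0 [i1 [_ -> ->]]] := descending_stat_top2 w. Qed.

(** If every value is at most [y], all [k] terms on the right are 1; otherwise
    only the index of the maximum can contribute. The identity turns the event
    [M1 <= x /\ M2 <= y], on which nothing can be computed by independence, into
    events that are products over the sample. *)
Lemma top2_count w x y : y <= x ->
  \1_[set w | M1 w <= x /\ M2 w <= y] w +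
    (k%:R - 1) * \1_[set w | M1 w <= y] w =
  \sum_(i < k) \1_[set w | U i w <= x /\ forall j, j != i -> U j w <= y] w
  :> R.
Proof.
move=> yx.
have [M1y|yM1] := leP (M1 w) y.
  rewrite !indicE !mem_set/=; [|exact: M1y|].
    rewrite (eq_bigr (fun=> 1)) => [|i _].
      by rewrite big_const_ord iter_addr_0; ring.
    move/max_le_iff : M1y => M1y.
    by rewrite indicE mem_set//=; split=> // ; exact: le_trans yx.
  split; first exact: le_trans yx.
  exact: le_trans (second_max_le_max w) M1y.
rewrite !indicE [X in _ + _ * (nat_of_bool X)%:R]memNset/=; last first.
  by apply/negP; rewrite -ltNge.
rewrite mulr0 addr0.
have [i0 [i1 [i01 M1E M2E i10 i1P]]] := descending_stat_top2 w.
rewrite (bigD1 i0)//= big1 ?addr0 => [|i ii0]; last first.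
  rewrite indicE memNset//= => -[_ /(_ i0)]; rewrite eq_sym => /(_ ii0).
  by rewrite -M1E leNgt yM1.
rewrite indicE; congr (nat_of_bool _)%:R; apply/idP/idP; rewrite !inE/= M1E M2E.
  by move=> [? i1y]; split=> // j /i1P/le_trans; apply.
by move=> [? iP]; split=> //; apply: iP; rewrite eq_sym.
Qed.

End top_two_order_statistics.

Arguments descending_stat_top2 {T R k U} hk w.
Arguments max_le_iff {T R k U} hk {w x}.
Arguments second_max_le_iff {T R k U} hk {w y}.
Arguments second_max_le_max {T R k U} hk w.
Arguments top2_count {T R k U} hk w {x y}.

(** * Truncated expectations from distribution functions *)

Section layer_cake.
Context d (T : measurableType d) (R : realType) (P : {sigma_finite_measure set T -> \bar R}).
Local Notation mu := (@lebesgue_measure R).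
Local Open Scope ereal_scope.

(** Tonelli's theorem, since [max (c - X) 0] is the length of the interval from
    [X] to [c]. The integral starts at minus infinity because [X] ranges over
    the whole line. *)
Lemma layer_cake (X g : T -> R) (c : R) :
  measurable_fun setT X -> measurable_fun setT g -> (forall w, 0 <= g w)%R ->
  \int[P]_w (g w * Num.max (c - X w) 0)%:E =
  \int[mu]_(y in `]-oo, c]) \int[P]_(w in [set w | X w <= y]%R) (g w)%:E.
Proof.
move=> mX mg g0.
pose f (p : T * measurableTypeR R) : \bar R :=
  (g p.1 * (if (X p.1 <= p.2 <= c)%R then 1 else 0))%:E.
have mf : measurable_fun setT f.
  apply/measurable_EFinP; apply: measurable_funM; first exact: measurableT_comp.
  apply: measurable_fun_ifT => //=.
  apply: measurable_and; apply: measurable_fun_ler => //.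
  exact: measurableT_comp.
have f0 p : 0 <= f p.
  by rewrite /f lee_fin mulr_ge0//; case: ifPn.
transitivity (\int[P]_w \int[mu]_y f (w, y)).
  apply: eq_integral => w _.
  rewrite (_ : (fun y => _) =
      fun y => (g w)%:E * (\1_(`[X w, c]%classic : set R) y)%:E)%E; last first.
    apply/funext => y; rewrite /f /= EFinM indicE; congr (_ * _%:E).
    by rewrite mem_setE in_itv/=; case: ifP.
  rewrite ge0_integralZl//=; [|exact/measurable_EFinP|by rewrite lee_fin].
  rewrite integral_indic//= setIT lebesgue_measure_itv/= lte_fin EFinM.
  have [Xc|cX] := ltP (X w) c.
    by rewrite -EFinB max_l// subr_ge0 ltW.
  by rewrite max_r// subr_le0.
rewrite (fubini_tonelli f)//.
rewrite [RHS]integral_mkcond/=; apply: eq_integral => y _.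
rewrite patchE; case: ifPn => yc; last first.
  apply: integral0_eq => w _; rewrite /f /=.
  by rewrite notin_setE/= in_itv/= in yc; move/negP/negbTE : yc => ->; rewrite andbF mulr0.
rewrite [RHS]integral_mkcond; apply: eq_integral => w _; rewrite /f/= patchE.
rewrite inE/= in_itv/= in yc; rewrite yc andbT.
case: ifPn => [Xy|/negP Xy]; first by rewrite mem_set// mulr1.
by rewrite memNset// mulr0.
Qed.

End layer_cake.

Section uniform_cdf_powers.
Context (R : realType).
Local Notation mu := (@lebesgue_measure R).

(** The base [max y 0 / N] is, for [y <= N], the distribution function of the
    uniform law on [[0, N]]. The exponent is positive so that the integrand
    vanishes for negative [y], and so does the value for negative [x]. *)
Lemma integral_uniform_cdf_exp (N x : R) (m : nat) : 0 < N -> (0 < m)%N ->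
  (\int[mu]_(y in `]-oo, x]) ((Num.max y 0 / N) ^+ m)%:E =
  (x * (Num.max x 0 / N) ^+ m / m.+1%:R)%:E)%E.
Proof.
move=> N0 m0.
have neg y : y <= 0 -> (Num.max y 0 / N) ^+ m = 0.
  by move=> y0; rewrite max_r// mul0r expr0n eqn0Ngt m0.
have [x0|x0] := leP x 0.
  rewrite mul0r expr0n eqn0Ngt m0 mulr0 mul0r; apply: integral0_eq => y/=.
  by rewrite in_itv/= => yx; rewrite neg// (le_trans yx).
have mF (D : set R) : measurable D ->
    measurable_fun D (fun y => ((Num.max y 0 / N) ^+ m)%:E).
  move=> mD; apply/measurable_EFinP/measurable_funTS.
  apply: measurable_funX; apply: measurable_funM => //.
  exact: measurable_maxr.
rewrite (@itv_bndbnd_setU _ _ -oo%O (BLeft 0) (BRight x)) ?bnd_simp ?ltW//.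
rewrite ge0_integral_setU//=; last 3 first.
- by apply: mF; exact: measurableU.
- by move=> y _; rewrite lee_fin exprn_ge0// divr_ge0// ?le_max ?lexx ?orbT// ltW.
- by apply/disj_setPRL => y/=; rewrite !in_itv/= => /andP[+ _] y0; rewrite leNgt y0.
rewrite integral0_eq ?add0e; last first.
  by move=> y/=; rewrite in_itv/= => y0; rewrite neg// ltW.
pose G (y : R) := (N ^- m * m.+1%:R^-1) * y ^+ m.+1.
have dG (y : R) : is_derive y 1 G (N ^- m * y ^+ m).
  have -> : G = (N ^- m * m.+1%:R^-1) \*: ((@id R) ^+ m.+1).
    by apply/funext => z; rewrite /= exprfctE.
  apply: is_derive_eq; rewrite /GRing.scale/= mulr1; field.
  by rewrite nat1r pnatr_eq0 expf_neq0// gt_eqF.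
transitivity (\int[mu]_(y in `[0%R, x]) (N ^- m * y ^+ m)%:E)%E.
  apply: eq_integral => y; rewrite inE/= in_itv/= => /andP[y0 _].
  by rewrite max_l// expr_div_n mulrC.
rewrite (@continuous_FTC2 _ _ G)//.
- rewrite /G expr0n mulr0 sube0 expr_div_n exprS; congr (_%:E).
  by field; rewrite nat1r pnatr_eq0 expf_neq0// gt_eqF.
- apply: continuous_subspaceT => y.
  by apply: cvgM; [exact: cvg_cst|exact: exprn_continuous].
- have cG : continuous G.
    by move=> y; apply: differentiable_continuous; apply/derivable1_diffP.
  split; first by move=> y _; exact: ex_derive.
  + exact/cvg_at_right_filter/cG.
  + exact/cvg_at_left_filter/cG.
- by move=> y _; rewrite derive1E; exact: derive_val.
Qed.

Lemma integrable_uniform_cdf_exp (N x : R) (m : nat) : 0 < N -> (0 < m)%N ->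
  mu.-integrable `]-oo, x] (fun y : R => ((Num.max y 0 / N) ^+ m)%:E).
Proof.
move=> N0 m0; apply/integrableP; split.
  apply/measurable_EFinP/measurable_funTS.
  apply: measurable_funX; apply: measurable_funM => //.
  exact: measurable_maxr.
apply: (le_lt_trans (y := (\int[mu]_(y in `]-oo, x]) ((Num.max y 0 / N) ^+ m)%:E)%E)); last first.
  by rewrite integral_uniform_cdf_exp// ltry.
rewrite le_eqVlt; apply/orP; left; apply/eqP/eq_integral => y _.
rewrite gee0_abs// lee_fin exprn_ge0// divr_ge0//.
  by rewrite le_max lexx orbT.
exact: ltW.
Qed.

End uniform_cdf_powers.

(** * Square-integrable variables *)

Section square_integrable.
Context d (T : measurableType d) (R : realType) (P : probability T R).

Lemma ae_bounded_Lfun (f : T -> R) (C : R) (r : R) : 1 <= r ->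
  measurable_fun setT f -> {ae P, forall w, `|f w| <= C} -> f \in Lfun P r%:E.
Proof.
move=> r1 mf fC; have PT : (P setT \is a fin_num) by exact: fin_num_measure.
apply: (@Lfun_subset _ _ _ P r%:E +oo%E) => //; rewrite ?leey//.
rewrite inE; apply/andP; split; rewrite inE//=.
rewrite /finite_norm unlock /Lnorm; case: ifPn => [_|_]; last by rewrite ltry.
by apply: (@le_lt_trans _ _ C%:E); [exact/ess_sup_inf.ess_supP|rewrite ltry].
Qed.

Lemma Lfun2_Lfun1 (f : T -> R) : f \in Lfun P 2%:E -> f \in Lfun P 1.
Proof. by apply: Lfun_subset12; exact: fin_num_measure. Qed.

Lemma Lfun2_affine (f g : T -> R) (a b : R) :
  f \in Lfun P 2%:E -> g \in Lfun P 2%:E ->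
  (fun w => a * f w + b * g w) \in Lfun P 2%:E.
Proof.
move=> f2 g2; have -> : (fun w => a * f w + b * g w) = (a \o* f) \+ (b \o* g).
  by apply/funext => w /=; rewrite [a * _]mulrC [b * _]mulrC.
have [af bg] := (Lfun_scale a (ler1n _ 2) f2, Lfun_scale b (ler1n _ 2) g2).
by apply: rpredD; rewrite ?lee1n.
Qed.

Lemma expectation_eq0_of_ae_sub (f g h : T -> R) : measurable_fun setT f ->
  g \in Lfun P 1 -> h \in Lfun P 1 -> {ae P, forall w, f w = g w - h w} ->
  ('E_P[g] = 'E_P[h] -> 'E_P[f] = 0)%E.
Proof.
move=> mf g1 h1 fgh gh.
have -> : ('E_P[f] = 'E_P[g \- h])%E.
  rewrite unlock; apply: ae_eq_integral => //.
  - exact/measurable_EFinP.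
  - apply/measurable_EFinP.
    move: g1 h1; rewrite !inE => /andP[+ _] /andP[+ _]; rewrite !inE/=.
    exact: measurable_funB.
  - by apply: filterS fgh => w/= ->.
by rewrite expectationB// gh subee// expectation_fin_num.
Qed.

(** Chebyshev's inequality bounds [P A] by a multiple of the variance. *)
Lemma variance_gt0 (f : T -> R) (e : R) (A : set T) : f \in Lfun P 2%:E ->
  ('E_P[f] = 0)%E -> 0 < e -> measurable A -> (forall w, A w -> e <= `|f w|) ->
  (0 < P A)%E -> (0 < 'V_P[f])%E.
Proof.
move=> f2 f0 e0 mA Ae PA.
have mf : f \in mfun by move: f2; rewrite inE => /andP[].
pose X : {RV P >-> R} := mfun_Sub mf.
have XE : (X : T -> R) = f by [].
have := chebyshev X e0; rewrite XE f0 /= => che.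
rewrite lt_neqAle variance_ge0 andbT eq_sym; apply/eqP => V0.
move: che; rewrite V0 mule0 leNgt => /negP; apply.
apply: (lt_le_trans PA); apply: le_measure; rewrite ?inE//.
  rewrite (_ : [set w | _] = ((@Num.norm _ R) \o f) @^-1` `[e, +oo[).
    rewrite -[X in measurable X]setTI; apply: measurableT_comp => //.
    by have := mf; rewrite inE.
  by apply/seteqP; split=> w /=; rewrite in_itv/= andbT subr0.
by move=> w /Ae; rewrite /= subr0.
Qed.

End square_integrable.

(** * Adding an uncorrelated variable *)

Section uncorrelated_perturbation.
Context d (T : measurableType d) (R : realType) (P : probability T R).
Variables X D : T -> R.
Hypotheses (X2 : X \in Lfun P 2%:E) (D2 : D \in Lfun P 2%:E).
Hypothesis covXD : covariance P X D = 0%E.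

Lemma variance_uncorrelated_line (t : R) :
  ('V_P[fun w => X w + t * D w]%R = 'V_P[X] + (t ^+ 2)%:E * 'V_P[D])%E.
Proof.
have -> : (fun w => X w + t * D w) = X \+ (t \o* D).
  by apply/funext => w /=; rewrite mulrC.
have tD2 : t \o* D \in Lfun P 2%:E by rewrite Lfun_scale// ler1n.
have [X1 D1] := (Lfun2_Lfun1 X2, Lfun2_Lfun1 D2).
rewrite varianceD// varianceZ// covarianceZr//; last exact: Lfun2_mul_Lfun1.
by rewrite covXD !mule0 adde0.
Qed.

Lemma weight_formula_uncorrelated : (0 < 'V_P[D])%E ->
  weight_formula P X (fun w => X w + D w) = 1%E.
Proof.
move=> VD0.
have VX := variance_fin_num X2; have VD := variance_fin_num D2.
have VY : ('V_P[fun w => X w + D w]%R = 'V_P[X] + 'V_P[D])%E.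
  have := variance_uncorrelated_line 1; rewrite expr1n mul1e => <-.
  by congr variance; apply/funext => w; rewrite mul1r.
have CY : covariance P X (fun w => X w + D w) = ('V_P[X])%E.
  by rewrite [LHS](covarianceDr X2 X2 D2) covXD adde0.
rewrite /weight_formula VY CY.
move: VD0; case: ('V_P[X])%E VX => // a _; case: ('V_P[D])%E VD => // b _.
rewrite lte_fin => b0; rewrite -!EFinM -!EFinD.
have -> : a + b - a = b by ring.
have -> : a + (a + b) - 2 * a = b by ring.
by rewrite inver gt_eqF// -EFinM divff// gt_eqF.
Qed.

End uncorrelated_perturbation.

(** * Distribution of the two largest values of a uniform sample *)

Lemma measurable_fun_sublevel d (T : measurableType d) (R : realType)
    (f : T -> R) :
  (forall x, measurable [set w | f w <= x]) -> measurable_fun setT f.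
Proof.
move=> mf; apply: (measurability _ (RGenOInfty.measurableE R)).
move=> _ [_ [x ->] <-]; rewrite setTI.
rewrite (_ : _ @^-1` _ = ~` [set w | f w <= x]); first exact: measurableC.
by apply/seteqP; split=> w /=; rewrite in_itv/= andbT ltNge => /negP.
Qed.

Section independent_uniform_sample.
Context d (T : measurableType d) (R : realType) (P : probability T R).
Context (k : nat) (N : R) (hN : 0 < N) (U : 'I_k -> {RV P >-> R}).
Hypothesis hk : (2 <= k)%N.
Hypothesis U_indep : mutually_independent U.
Hypothesis U_unif : forall i, uniformly_distributed (U i) hN.
Local Notation mu := (@lebesgue_measure R).
Local Notation M1 := (descending_stat U 0).
Local Notation M2 := (descending_stat U 1).
Local Notation F := (fun y : R => Num.max y 0 / N).

Let measurable_sample i (A : set R) : measurable A -> measurable (U i @^-1` A).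
Proof. by move=> mA; rewrite -[X in measurable X]setTI; exact: measurable_funP. Qed.

Lemma measurable_max : measurable_fun setT M1.
Proof.
apply: measurable_fun_sublevel => x.
rewrite (_ : [set w | _] = \bigcap_(i in [set: 'I_k]) (U i @^-1` `]-oo, x])).
  apply: fin_bigcap_measurable => // i _.
  exact: measurable_sample.
apply/seteqP; split=> w.
  by move=> /= /(max_le_iff hk) M1x i _ /=; rewrite in_itv/=.
move=> M1x; apply/(max_le_iff hk) => i.
by have := M1x i Logic.I; rewrite /= in_itv.
Qed.

Lemma measurable_second_max : measurable_fun setT M2.
Proof.
apply: measurable_fun_sublevel => y.
rewrite (_ : [set w | _] = \bigcup_(i in [set: 'I_k])
    \bigcap_(j in [set j | j != i]) (U j @^-1` `]-oo, y])).
  apply: fin_bigcup_measurable => // i _.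
  apply: fin_bigcap_measurable => [|j _]; first exact: finite_finset.
  exact: measurable_sample.
apply/seteqP; split=> w.
  by move=> /(second_max_le_iff hk) [i iP]; exists i.
move=> [i _ iP]; apply/(second_max_le_iff hk); exists i => j ji.
by have := iP j ji; rewrite /= in_itv.
Qed.

Lemma uniform_cdf i y : y <= N -> P (U i @^-1` `]-oo, y]) = (F y)%:E.
Proof.
move=> yN.
have := U_unif i (measurable_itv `]-oo, y]); rewrite /distribution/= /pushforward => ->.
rewrite /uniform_prob integral_uniform_pdf.
have [y0|y0] := leP 0 y; last first.
  rewrite mul0r (_ : _ `&` _ = set0) ?integral_set0//.
  apply/seteqP; split=> z //=; rewrite !in_itv/= => -[zy /andP[z0 _]].
  by move: (le_lt_trans (le_trans z0 zy) y0); rewrite ltxx.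
rewrite (_ : _ `&` _ = `[0, y]%classic).
  rewrite (eq_integral (fun=> N^-1%:E)).
    rewrite integral_cst//= lebesgue_measure_itv/= lte_fin.
    move: y0; rewrite le_eqVlt => /predU1P[<-|->].
      by rewrite ltxx mule0 mul0r.
    by rewrite -EFinD subr0 -EFinM mulrC.
  move=> z; rewrite inE/= in_itv/= => /andP[z0 zy].
  by rewrite /uniform_pdf z0 (le_trans zy)// subr0.
apply/seteqP; split=> z /=; rewrite !in_itv/=.
  by move=> [-> /andP[->]].
by move=> /andP[-> zy]; split => //=; exact: le_trans zy yN.
Qed.

Lemma uniform_ae_bounded i : {ae P, forall w, 0 <= U i w <= N}.
Proof.
exists (U i @^-1` (~` `[0, N])); split.
- by apply: measurable_sample; exact: measurableC.
- have := U_unif i (measurableC (measurable_itv `[0, N])).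
  rewrite /distribution/= /pushforward => ->.
  by rewrite /uniform_prob integral_uniform_pdf setICl integral_set0.
- by move=> w /= /negP wN; rewrite in_itv/=; exact/negP.
Qed.

Lemma indep_bigcap (A : 'I_k -> set R) : (forall i, measurable (A i)) ->
  P (\bigcap_(i in [set: 'I_k]) (U i @^-1` A i)) =
  (\prod_(i < k) P (U i @^-1` A i))%E.
Proof.
move=> mA; have := U_indep [set: 'I_k]%SET mA.
rewrite (_ : [set` _] = [set: 'I_k]); last by apply/seteqP; split=> i //=; rewrite inE.
by move=> ->; apply: eq_bigl => i; rewrite inE.
Qed.

Lemma one_against_others_cdf i x y : x <= N -> y <= N ->
  P [set w | U i w <= x /\ forall j, j != i -> U j w <= y] =
  (F x * F y ^+ k.-1)%:E.
Proof.
move=> xN yN.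
pose A j : set R := if j == i then `]-oo, x]%classic else `]-oo, y]%classic.
rewrite (_ : [set w | _] = \bigcap_(i in [set: 'I_k]) (U i @^-1` A i)).
  rewrite indep_bigcap; last by move=> j; rewrite /A; case: ifP.
  rewrite (bigD1 i)//= {1}/A eqxx uniform_cdf//.
  rewrite (eq_bigr (fun=> (F y)%:E)); last first.
    by move=> j ji; rewrite /A (negbTE ji) uniform_cdf.
  by rewrite prodEFin prodr_const -EFinM cardC1 card_ord.
apply/seteqP; split=> w /=.
  move=> [ix jy] j _; rewrite /A /=; case: eqP => [->|/eqP ji];
  by rewrite /= in_itv//=; exact: jy.
move=> AP; split.
  by have := AP i Logic.I; rewrite /A eqxx /= in_itv.
by move=> j ji; have := AP j Logic.I; rewrite /A (negbTE ji) /= in_itv.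
Qed.

Lemma max_cdf y : y <= N -> P [set w | M1 w <= y] = (F y ^+ k)%:E.
Proof.
move=> yN; have k0 : (0 < k)%N by exact: leq_trans hk.
pose i0 := Ordinal k0.
have -> : F y ^+ k = F y * F y ^+ k.-1 by rewrite -exprS prednK.
rewrite -(one_against_others_cdf i0)//; congr (P _).
apply/seteqP; split=> w /=; first by move=> /(max_le_iff hk).
move=> [i0y jy]; apply/(max_le_iff hk) => j.
by have [->//|/jy] := eqVneq j i0.
Qed.

Let measurable_max_le x : measurable [set w | M1 w <= x].
Proof.
rewrite (_ : [set w | _] = M1 @^-1` `]-oo, x]).
  by rewrite -[X in measurable X]setTI; exact: measurable_max.
by apply/seteqP; split=> w; rewrite /= in_itv.
Qed.

Let measurable_second_max_le y : measurable [set w | M2 w <= y].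
Proof.
rewrite (_ : [set w | _] = M2 @^-1` `]-oo, y]).
  by rewrite -[X in measurable X]setTI; exact: measurable_second_max.
by apply/seteqP; split=> w; rewrite /= in_itv.
Qed.

Let measurable_joint i x y :
  measurable [set w | U i w <= x /\ forall j, j != i -> U j w <= y].
Proof.
rewrite (_ : [set w | _] = (U i @^-1` `]-oo, x]) `&`
    \bigcap_(j in [set j | j != i]) (U j @^-1` `]-oo, y])).
  apply: measurableI; first exact: measurable_sample.
  apply: fin_bigcap_measurable => [|j _]; first exact: finite_finset.
  exact: measurable_sample.
apply/seteqP; split=> w /=; rewrite in_itv/= => -[ix jy]; split=> // j /jy;
by rewrite /= in_itv.
Qed.

(** Integrating [top2_count] leaves only events whose probability is a product. *)
Lemma top2_cdf x y : x <= N -> y <= x ->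
  P [set w | M1 w <= x /\ M2 w <= y] =
  (k%:R * F x * F y ^+ k.-1 - (k%:R - 1) * F y ^+ k)%:E.
Proof.
move=> xN yx; have yN := le_trans yx xN.
have k1 : 0 <= k%:R - 1 :> R by rewrite subr_ge0 ler1n ltnW.
pose S := [set w | M1 w <= x /\ M2 w <= y].
pose S1 := [set w | M1 w <= y].
pose E i := [set w | U i w <= x /\ forall j, j != i -> U j w <= y].
have mS : measurable S.
  exact: measurableI (measurable_max_le x) (measurable_second_max_le y).
have mS1 : measurable S1 by exact: measurable_max_le.
have mE i : measurable (E i) by exact: measurable_joint.
have : (P S + (k%:R - 1)%:E * P S1 = \sum_(i < k) P (E i))%E.
  transitivity (\int[P]_w (\1_S w + (k%:R - 1) * \1_S1 w)%:E)%E.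
    under eq_integral do rewrite EFinD EFinM.
    rewrite ge0_integralD//=; last 3 first.
    - exact/measurable_EFinP.
    - by move=> w _; rewrite mule_ge0// lee_fin.
    - by apply: measurable_funeM; exact/measurable_EFinP.
    rewrite ge0_integralZl//=; last exact/measurable_EFinP.
    by rewrite !integral_indic// !setIT.
  under eq_integral do rewrite (top2_count hk _ yx) -sumEFin.
  rewrite ge0_integral_sum//=; last first.
    by move=> i; apply/measurable_EFinP; exact: measurable_indic.
  by apply: eq_bigr => i _; rewrite integral_indic// setIT.
rewrite max_cdf// (eq_bigr (fun=> (F x * F y ^+ k.-1)%:E)); last first.
  by move=> i _; rewrite one_against_others_cdf.
have : P S \is a fin_num by exact: fin_num_measure.
rewrite sumEFin big_const_ord iter_addr_0 -/S.
case: (P S) => // p _ [pE]; congr (_%:E).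
by rewrite -mulrA mulr_natl -pE; ring.
Qed.

(** * The second largest value given the largest *)

(** The truncated gap below the maximum and the next lemma's gap below the second
    largest value, restricted to [M1 <= x], have expectations in the ratio 1 : 2.
    This is the familiar fact that [k] uniform points cut the interval [[0, x]]
    into [k + 1] pieces of equal mean length, [F x ^+ k] being the probability
    that all points fall below [x]. *)
Lemma expected_gap_below_max x : x <= N ->
  (\int[P]_w (Num.max (x - M1 w) 0)%:E = (x * F x ^+ k / k.+1%:R)%:E)%E.
Proof.
move=> xN; have k0 : (0 < k)%N by exact: leq_trans hk.
rewrite -(integral_uniform_cdf_exp x hN k0).
transitivity (\int[P]_w (cst 1 w * Num.max (x - M1 w) 0)%:E)%E.
  by apply: eq_integral => w _; rewrite /= mul1r.
rewrite layer_cake//; last exact: measurable_max.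
apply: eq_integral => y; rewrite inE/= in_itv/= => yx.
by rewrite integral_cst//= mul1e max_cdf// (le_trans yx).
Qed.

Lemma expected_second_gap_below_max x : x <= N ->
  (\int[P]_w (\1_[set w | (M1 w <= x)%R] w * Num.max (x - M2 w) 0)%:E =
   (2 * (x * F x ^+ k / k.+1%:R))%:E)%E.
Proof.
move=> xN; have k0 : (0 < k)%N by exact: leq_trans hk.
have k1 : (0 < k.-1)%N by rewrite -subn1 subn_gt0.
rewrite layer_cake//; last exact: measurable_second_max.
transitivity (\int[mu]_(y in `]-oo, x])
    ((k%:R * F x)%:E * (F y ^+ k.-1)%:E - (k%:R - 1)%:E * (F y ^+ k)%:E))%E.
  apply: eq_integral => y; rewrite inE/= in_itv/= => yx.
  by rewrite integral_indic//= top2_cdf.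
have int1 := integrable_uniform_cdf_exp x hN k1.
have intk := integrable_uniform_cdf_exp x hN k0.
rewrite integralB//=; [|exact: integrableZl|exact: integrableZl].
rewrite !integralZl// !integral_uniform_cdf_exp// -!EFinM -EFinB; congr (_%:E).
have -> : F x ^+ k = F x * F x ^+ k.-1 by rewrite -exprS prednK.
rewrite prednK// -natr1; field.
by rewrite natr1 !pnatr_eq0 (gt_eqF hN) (eqn0Ngt k) k0.
Qed.

Let integral_affine (S : set T) (c e : R) (h : T -> R) : measurable S ->
    0 <= c -> 0 <= e -> measurable_fun setT h -> (forall w, 0 <= h w) ->
  (\int[P]_(w in S) (c + e * h w)%:E =
   c%:E * P S + e%:E * \int[P]_(w in S) (h w)%:E)%E.
Proof.
move=> mS c0 e0 mh h0; have mSh : measurable_fun S (fun w => (h w)%:E).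
  by apply/measurable_EFinP; exact: measurable_funTS.
under eq_integral do rewrite EFinD EFinM.
rewrite ge0_integralD//=; last 2 first.
- by move=> w _; rewrite mule_ge0// lee_fin.
- exact: measurable_funeM.
by rewrite integral_cst// ge0_integralZl// => w _; rewrite lee_fin.
Qed.

Local Notation gap1 := (fun w => Num.max (N - M1 w) 0).
Local Notation gap2 := (fun w => Num.max (N - M2 w) 0).

Let measurable_gap1 x : measurable_fun setT (fun w => Num.max (x - M1 w) 0).
Proof.
apply: measurable_maxr => //; apply: measurable_funB => //.
exact: measurable_max.
Qed.

Let measurable_gap2 x : measurable_fun setT (fun w => Num.max (x - M2 w) 0).
Proof.
apply: measurable_maxr => //; apply: measurable_funB => //.
exact: measurable_second_max.
Qed.

Let gap_ge0 (c t : R) : 0 <= Num.max (c - t) 0.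
Proof. by rewrite le_max lexx orbT. Qed.

Let gap_shift (x t : R) : x <= N -> t <= x ->
  Num.max (N - t) 0 = (N - x) + Num.max (x - t) 0.
Proof.
move=> xN tx; rewrite !max_l ?subr_ge0//; first by ring.
exact: le_trans xN.
Qed.

(** This is [E (M2 | M1) = (k - 1) / k * M1], written with the nonnegative
    variables [N - M1] and [N - M2]: almost surely the difference of the two
    integrands is [k * M2 - (k - 1) * M1]. Writing [N - M1 = (N - x) + (x - M1)]
    on the event [M1 <= x] reduces it to the two preceding expectations. *)
Lemma conditional_expectation_second_max x : x <= N ->
  (\int[P]_(w in [set w | (M1 w <= x)%R]) (N + (k%:R - 1) * gap1 w)%:E =
   \int[P]_(w in [set w | (M1 w <= x)%R]) (k%:R * gap2 w)%:E)%E.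
Proof.
move=> xN; set S := [set w | _].
have mS : measurable S by exact: measurable_max_le.
have k1 : 0 <= k%:R - 1 :> R by rewrite subr_ge0 ler1n ltnW.
have Nx : 0 <= N - x by rewrite subr_ge0.
have -> : (\int[P]_(w in S) (N + (k%:R - 1) * gap1 w)%:E =
    \int[P]_(w in S)
      (N + (k%:R - 1) * (N - x) + (k%:R - 1) * Num.max (x - M1 w) 0)%:E)%E.
  apply: eq_integral => w; rewrite inE => wS.
  by rewrite (gap_shift xN)// mulrDr addrA.
have -> : (\int[P]_(w in S) (k%:R * gap2 w)%:E =
    \int[P]_(w in S) (k%:R * (N - x) + k%:R * Num.max (x - M2 w) 0)%:E)%E.
  apply: eq_integral => w; rewrite inE => wS.
  by rewrite (gap_shift xN)// ?mulrDr//; exact: le_trans (second_max_le_max hk w) _.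
rewrite !integral_affine// ?addr_ge0// ?mulr_ge0//; last exact: ltW.
have -> : (\int[P]_(w in S) (Num.max (x - M1 w) 0)%:E =
    (x * F x ^+ k / k.+1%:R)%:E)%E.
  rewrite -expected_gap_below_max// integral_mkcond; apply: eq_integral => w _.
  rewrite patchE; case: ifPn => //; rewrite notin_setE /S/= => /negP wx.
  by rewrite max_r// subr_le0 ltW// ltNge.
have -> : (\int[P]_(w in S) (Num.max (x - M2 w) 0)%:E =
    (2 * (x * F x ^+ k / k.+1%:R))%:E)%E.
  rewrite -expected_second_gap_below_max// integral_mkcond.
  apply: eq_integral => w _; rewrite patchE indicE -/S.
  by case: ifPn => _; rewrite ?mul1r ?mul0r.
rewrite max_cdf// -!EFinM -!EFinD; congr (_%:E).
rewrite -natr1; field.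
by rewrite natr1 pnatr_eq0.
Qed.

(** Both sides are, by [layer_cake], integrals over [y <= N] of the expectations
    restricted to [M1 <= y] that [conditional_expectation_second_max] equates. *)
Lemma gap_orthogonality :
  (\int[P]_w ((N + (k%:R - 1) * gap1 w) * gap1 w)%:E =
   \int[P]_w ((k%:R * gap2 w) * gap1 w)%:E)%E.
Proof.
have k1 : 0 <= k%:R - 1 :> R by rewrite subr_ge0 ler1n ltnW.
rewrite layer_cake; last 3 first.
- exact: measurable_max.
- by apply: measurable_funD => //; apply: measurable_funM.
- by move=> w; rewrite addr_ge0 ?mulr_ge0// ltW.
rewrite layer_cake; last 3 first.
- exact: measurable_max.
- exact: measurable_funM.
- by move=> w; rewrite mulr_ge0.
apply: eq_integral => y; rewrite inE/= in_itv/= => yN.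
exact: conditional_expectation_second_max.
Qed.

Lemma ae_bounded_top2 :
  {ae P, forall w, (0 <= M2 w) /\ (M1 w <= N)}.
Proof.
have : {ae P, forall w, forall i, 0 <= U i w <= N}.
  apply: filter_forall.
  exact: uniform_ae_bounded.
apply: filterS => w UN; split.
  by have [i0 [i1 [_ _ -> _ _]]] := descending_stat_top2 (U := U) hk w; case/andP: (UN i1).
by apply/(max_le_iff hk) => i; case/andP: (UN i).
Qed.

(** * The residual of the second largest value *)

Local Notation W := (fun w => k%:R * M2 w - (k%:R - 1) * M1 w).
Local Notation g1 := (fun w => N + (k%:R - 1) * gap1 w).
Local Notation g2 := (fun w => k%:R * gap2 w).

Let k1_ge0 : 0 <= k%:R - 1 :> R.
Proof. by rewrite subr_ge0 ler1n ltnW. Qed.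

Let measurable_g1 : measurable_fun setT g1.
Proof. by apply: measurable_funD => //; exact: measurable_funM. Qed.

Let measurable_g2 : measurable_fun setT g2.
Proof. exact: measurable_funM. Qed.

Let measurable_W : measurable_fun setT W.
Proof.
by apply: measurable_funB; apply: measurable_funM => //;
  [exact: measurable_second_max|exact: measurable_max].
Qed.

Lemma max_Lfun2 : M1 \in Lfun P 2%:E.
Proof.
apply: (@ae_bounded_Lfun _ _ _ _ _ N); rewrite ?ler1n//.
  exact: measurable_max.
apply: filterS ae_bounded_top2 => w [M20 M1N].
by rewrite ger0_norm// (le_trans M20)// second_max_le_max.
Qed.

Lemma second_max_Lfun2 : M2 \in Lfun P 2%:E.
Proof.
apply: (@ae_bounded_Lfun _ _ _ _ _ N); rewrite ?ler1n//.
  exact: measurable_second_max.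
apply: filterS ae_bounded_top2 => w [M20 M1N].
by rewrite ger0_norm// (le_trans _ M1N)// second_max_le_max.
Qed.

Let W2 : W \in Lfun P 2%:E.
Proof.
have -> : W = fun w => k%:R * M2 w + (- (k%:R - 1)) * M1 w.
  by apply/funext => w; rewrite mulNr.
by apply: Lfun2_affine; [exact: second_max_Lfun2|exact: max_Lfun2].
Qed.

Let gap1_2 : gap1 \in Lfun P 2%:E.
Proof.
apply: (@ae_bounded_Lfun _ _ _ _ _ N); rewrite ?ler1n//.
apply: filterS ae_bounded_top2 => w [M20 M1N].
rewrite ger0_norm// ge_max (ltW hN) andbT gerBl.
exact: le_trans (second_max_le_max hk w).
Qed.

Let g1_2 : g1 \in Lfun P 2%:E.
Proof.
have -> : g1 = fun w => N * cst 1 w + (k%:R - 1) * gap1 w.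
  by apply/funext => w; rewrite /= mulr1.
by apply: Lfun2_affine => //; exact: Lfun_cst.
Qed.

Let g2_2 : g2 \in Lfun P 2%:E.
Proof.
apply: (@ae_bounded_Lfun _ _ _ _ _ (k%:R * N)); rewrite ?ler1n//.
apply: filterS ae_bounded_top2 => w [M20 M1N].
rewrite ger0_norm ?mulr_ge0// ler_wpM2l// ge_max (ltW hN) andbT.
by rewrite gerBl.
Qed.

Let ae_W : {ae P, forall w, W w = g1 w - g2 w}.
Proof.
apply: filterS ae_bounded_top2 => w [M20 M1N].
rewrite !max_l ?subr_ge0//; first by ring.
exact: le_trans (second_max_le_max hk w) M1N.
Qed.

Let ae_gap1 : {ae P, forall w, gap1 w = N - M1 w}.
Proof.
by apply: filterS ae_bounded_top2 => w [_ M1N]; rewrite max_l// subr_ge0.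
Qed.

Let integral_max_le (g : T -> R) : measurable_fun setT g ->
  (\int[P]_w (g w)%:E = \int[P]_(w in [set w | (M1 w <= N)%R]) (g w)%:E)%E.
Proof.
move=> mg; rewrite [RHS]integral_mkcond; apply: ae_eq_integral => //.
- exact/measurable_EFinP.
- apply/measurable_restrict => //.
  by apply/measurable_EFinP; rewrite setTI; exact: measurable_funTS.
apply: filterS ae_bounded_top2 => w [_ M1N] _.
by rewrite patchE mem_set.
Qed.

Lemma expectation_residual : ('E_P[W] = 0)%E.
Proof.
apply: (expectation_eq0_of_ae_sub measurable_W (Lfun2_Lfun1 g1_2)
  (Lfun2_Lfun1 g2_2) ae_W).
rewrite unlock !integral_max_le//.
exact: conditional_expectation_second_max.
Qed.

Lemma covariance_max_residual : (covariance P M1 W = 0)%E.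
Proof.
(* M1 * W = N * W - (N - M1) * W, and both terms have mean zero *)
have M1W : (M1 * W)%R \in Lfun P 1 by exact: Lfun2_mul_Lfun1 max_Lfun2 W2.
rewrite covarianceE ?(Lfun2_Lfun1 max_Lfun2) ?(Lfun2_Lfun1 W2)//.
rewrite expectation_residual mule0 sube0.
pose V := fun w => (N - M1 w) * W w.
have V2 : V \in Lfun P 1.
  apply: Lfun2_mul_Lfun1 => //=.
  rewrite (_ : (fun w => N - M1 w) = fun w => N * cst 1 w + (- 1) * M1 w).
    by apply: Lfun2_affine; [exact: Lfun_cst|exact: max_Lfun2].
  by apply/funext => w; rewrite /= mulr1 mulN1r.
have V0 : ('E_P[V] = 0)%E.
  apply: (@expectation_eq0_of_ae_sub _ _ _ _ _
    (fun w => g1 w * gap1 w) (fun w => g2 w * gap1 w)).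
  - apply: measurable_funM => //; apply: measurable_funB => //.
    exact: measurable_max.
  - exact: Lfun2_mul_Lfun1.
  - exact: Lfun2_mul_Lfun1.
  - move: ae_gap1 ae_W; apply: filterS2 => w gapE W12.
    have -> : V w = gap1 w * W w by rewrite gapE.
    by rewrite W12; ring.
  - by rewrite unlock gap_orthogonality.
have -> : (M1 * W)%R = (N \o* W) \- V.
  by apply/funext => w; rewrite mulrfctE /V /=; ring.
rewrite expectationB//; last by apply: Lfun_scale => //; exact: Lfun2_Lfun1.
by rewrite expectationZl ?Lfun2_Lfun1// expectation_residual V0 mule0 sube0.
Qed.

(** On the event [S] below, [W <= k * N / 8 - (k - 1) * N / 2], which is at most
    [- N / 4] because [k >= 2]. *)
Lemma variance_residual_gt0 : ('V_P[W] > 0)%E.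
Proof.
pose i0 : 'I_k := Ordinal (ltnW hk).
pose A j : set R := if j == i0 then `]N / 2, +oo[%classic else `]-oo, N / 8]%classic.
pose S := \bigcap_(i in [set: 'I_k]) (U i @^-1` A i).
have mA j : measurable (A j) by rewrite /A; case: ifP.
have mS : measurable S.
  apply: fin_bigcap_measurable => // i _.
  exact: measurable_sample.
apply: (@variance_gt0 _ _ _ _ _ (N / 4) S) => //.
- exact: expectation_residual.
- by rewrite divr_gt0.
- move=> w Sw.
  have M1w : N / 2 < M1 w.
    have := Sw i0 Logic.I; rewrite /A eqxx /= in_itv/= andbT => /lt_le_trans; apply.
    exact: (max_le_iff (U := U) hk).1 (lexx _) i0.
  have M2w : M2 w <= N / 8.
    apply/(second_max_le_iff hk); exists i0 => j ji0.
    by have := Sw j Logic.I; rewrite /A (negbTE ji0) /= in_itv.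
  have k2 : 2 <= k%:R :> R by rewrite ler_nat.
  have kM2 : k%:R * M2 w <= k%:R * (N / 8) by rewrite ler_wpM2l.
  have kM1 : (k%:R - 1) * (N / 2) <= (k%:R - 1) * M1 w.
    by rewrite ler_wpM2l// ltW.
  have kN : 2 * N <= k%:R * N by rewrite ler_wpM2r// ltW.
  have WN : W w <= - (N / 4) by rewrite /=; lra.
  rewrite ler0_norm; last by rewrite (le_trans WN)// oppr_le0 divr_ge0// ltW.
  by rewrite lerNr.
- rewrite /S indep_bigcap//.
  rewrite (eq_bigr (fun i => (if i == i0 then 2^-1 else 8^-1)%:E)); last first.
    move=> i _; rewrite /A; case: eqP => _.
      rewrite (_ : `]N / 2, +oo[%classic = ~` `]-oo, N / 2]); last by rewrite setCitvl.
      rewrite preimage_setC probability_setC//.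
        rewrite uniform_cdf.
          rewrite max_l -?EFinB; [|by rewrite divr_ge0// ltW].
          by congr (_%:E); field; rewrite gt_eqF.
        by rewrite ler_pdivrMr// ler_peMr ?ler1n// ltW.
      exact: (measurable_sample i (measurable_itv `]-oo, N / 2])).
    rewrite uniform_cdf; last by rewrite ler_pdivrMr// ler_peMr ?ler1n// ltW.
    rewrite max_l; [|by rewrite divr_ge0// ltW].
    by congr (_%:E); field; rewrite gt_eqF.
  by rewrite prodEFin lte_fin prodr_gt0// => i _; case: ifP.
Qed.

End independent_uniform_sample.

(** * The optimal weight *)

Theorem mainTheorem2 (d : measure_display) (T : measurableType d)
    (R : realType) (P : probability T R) (k : nat) (hk : (2 <= k)%N)
    (N : R) (hN : 0 < N) (U : 'I_k -> {RV P >-> R})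
    (U_indep : mutually_independent U)
    (U_unif : forall i, uniformly_distributed (U i) hN) :
  let X_k := max_estimator U in
  let X_k1 := second_max_estimator U in
  let X_ := weighted_estimator U in
  (forall alpha : R, 0 <= alpha <= 1 ->
    (forall beta : R, 0 <= beta <= 1 -> ('V_P[X_ alpha] <= 'V_P[X_ beta])%E)
    <-> alpha%:E = weight_formula P X_k X_k1) /\
  weight_formula P X_k X_k1 = 1%E.
Proof.
move=> X_k X_k1 X_.
(* the factor by which X_k1 - X_k exceeds k * M2 - (k - 1) * M1 is c *)
pose W w := k%:R * descending_stat U 1 w - (k%:R - 1) * descending_stat U 0 w.
pose c : R := (k%:R + 1) / (k%:R * (k%:R - 1)).
pose D := c \o* W.
have k0 : k%:R != 0 :> R by rewrite pnatr_eq0 -lt0n ltnW.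
have k1 : k%:R - 1 != 0 :> R by rewrite subr_eq0 pnatr_eq1 gtn_eqF.
have c0 : c != 0.
  by rewrite mulf_neq0 ?invr_eq0 ?mulf_neq0// natr1 pnatr_eq0.
have XD : X_k1 = fun w => X_k w + D w.
  apply/funext => w; rewrite /X_k1 /X_k /D /W /c /second_max_estimator.
  by rewrite /max_estimator /=; field; rewrite k0 k1.
have M12 := max_Lfun2 hk U_unif.
have W2 : W \in Lfun P 2%:E.
  have -> : W = fun w => k%:R * descending_stat U 1 w +
                         (- (k%:R - 1)) * descending_stat U 0 w.
    by apply/funext => w; rewrite mulNr.
  exact: Lfun2_affine (second_max_Lfun2 hk U_unif) M12.
have X2 : X_k \in Lfun P 2%:E by apply: Lfun_scale; rewrite ?ler1n.
have D2 : D \in Lfun P 2%:E by apply: Lfun_scale; rewrite ?ler1n.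
have covXD : covariance P X_k D = 0%E.
  have [[M11 W1] D1] := (Lfun2_Lfun1 M12, Lfun2_Lfun1 W2, Lfun2_Lfun1 D2).
  rewrite covarianceZl//; last exact: Lfun2_mul_Lfun1.
  rewrite covarianceZr//; last exact: Lfun2_mul_Lfun1.
  by rewrite (covariance_max_residual hk U_indep U_unif) !mule0.
have VD : (0 < 'V_P[D])%E.
  rewrite varianceZ// mule_gt0 ?lte_fin ?exprn_even_gt0//.
  exact: (variance_residual_gt0 hk U_indep U_unif).
have VX alpha : ('V_P[X_ alpha] = 'V_P[X_k] + ((1 - alpha) ^+ 2)%:E * 'V_P[D])%E.
  rewrite -variance_uncorrelated_line//; congr variance; apply/funext => w.
  rewrite /X_ /weighted_estimator -/X_k -/X_k1 XD; ring.
have w1 : weight_formula P X_k X_k1 = 1%E.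
  by rewrite XD; exact: weight_formula_uncorrelated.
split=> // alpha _; rewrite w1; split=> [min_alpha|[->] beta _].
  have := min_alpha 1; rewrite ler01 lexx => /(_ isT).
  rewrite !VX leeD2lE ?variance_fin_num// subrr expr0n mul0e.
  rewrite pmule_lle0// lee_fin => sq0; congr (_%:E); apply/esym/eqP.
  by rewrite -subr_eq0 -sqrf_eq0 eq_le sq0 sqr_ge0.
rewrite !VX subrr expr0n mul0e adde0 leeDl// mule_ge0 ?variance_ge0//.
by rewrite lee_fin sqr_ge0.
Qed.
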